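(* There exist absolute constants $K>0$ and $\epsilon_0\in(0,1)$ such that the following holds. Let $d\ge1$, let $A$ be a finite subset of $(\mathbb{R}/\mathbb{Z})^d$ with $|A|\ge2$, and let $0<\epsilon\le\epsilon_0$. For each $a\in A$ let $N_a$ be an element of $A\setminus\{a\}$ nearest to $a$ in the norm $\|\cdot\|$. Then there exists $A'\subseteq A$ with $|A'|\ge(1-\epsilon)|A|$ such that $$|\{N_a-a: a\in A'\}|\le K\left(\tfrac43\right)^d\cdot\min_{B}\frac{|A+B|^2}{|A||B|}\cdot\frac1\epsilon\log\frac1\epsilon,$$ where the minimum is over nonempty finite subsets $B\subseteq(\mathbb{R}/\mathbb{Z})^d$.
   Context: For $t=(t_1,\dots,t_d)\in(\mathbb{R}/\mathbb{Z})^d$, $\|t\|=\min_{n\in\mathbb{Z}^d}|t-n|=\left(\sum_{i=1}^d\min_{n_i\in\mathbb{Z}}|t_i-n_i|^2\right)^{1/2}$. $A+B=\{a+b: a\in A,b\in B\}$. *)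

(* Defs.v *)
From HB Require Import structures.
From mathcomp Require Import all_boot all_order all_algebra.
From mathcomp Require Import finmap.
From mathcomp Require Import all_classical all_reals.
From mathcomp Require Import Rstruct exp.
Set Implicit Arguments. Unset Strict Implicit. Unset Printing Implicit Defensive.
Import Order.TTheory GRing.Theory Num.Theory.
Local Open Scope ring_scope.
Local Open Scope fset_scope.

Notation RR := Rdefinitions.R.

(* Points of R^d as row vectors. The torus (R/Z)^d is represented by the
   fundamental domain [0,1)^d: a point of the torus is a vector all of whose
   coordinates lie in [0,1). *)
Definition vec (d : nat) := 'rV[RR]_d.

Definition frac (t : RR) : RR := t - (Num.floor t)%:~R.

Definition red (d : nat) (x : vec d) : vec d := \row_i frac (x ord0 i).

Definition is_torus_pt (d : nat) (x : vec d) : Prop :=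
  forall i, 0 <= x ord0 i < 1.

Definition tadd (d : nat) (x y : vec d) : vec d := red (x + y)%R.
Definition tsub (d : nat) (x y : vec d) : vec d := red (x - y)%R.

Definition distZ (t : RR) : RR := Num.min (frac t) (1 - frac t).

Definition tnorm (d : nat) (t : vec d) : RR :=
  Num.sqrt (\sum_(i < d) (distZ (t ord0 i)) ^+ 2).

Definition sumset (d : nat) (A B : {fset vec d}) : {fset vec d} :=
  [fset tadd a b | a in A, b in B].

Definition nearest_sel (d : nat) (A : {fset vec d}) (N : vec d -> vec d) : Prop :=
  forall a, a \in A ->
    [/\ N a \in A, N a != a &
        forall b, b \in A -> b != a -> tnorm (tsub (N a) a) <= tnorm (tsub b a)].

(* Main.v *)
(* A pair (a, b) in A * B is good when the ball around a + b of radius |N_a - a| contains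
   at most k points of A + B. If every point lies in at most M of the balls around the
   points a of A with these radii, double counting makes most pairs good as soon as k is
   of order M |A+B| / (eps |A|). A good pair yields the pair (a + b, N_a + b) of points of
   A + B, whose second member is one of the k nearest to the first; as (N_a - a, b) can be
   recovered from it once one a is fixed for each difference, there are at most
   k |A+B| / (|B| / 2) differences.

   Seen from a common point of the balls, their centres are pairwise separated by an angle
   of at least 60 degrees, so M exceeds the kissing number by at most one. That the latter
   is O((4/3)^d) is the Kabatiansky-Levenshtein linear programming bound. With P_n the
   Gegenbauer polynomials, P_n(x.y) is a Gram kernel of rank at most the number of
   monomials of degree n. Take g a combination of the P_n over a window of degrees near
   0.08 d such that (t - 1/2) g(t) has nonnegative Gegenbauer coefficients. Summing
   (t - 1/2) g(t)^2 over the pairs from a set of N directions, the nonpositive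
   off-diagonal terms leave at most a constant times N, while positivity and the rank
   bound give at least a constant times N^2 divided by the rank. *)

Require Import Defs.
From HB Require Import structures.
From mathcomp Require Import all_boot all_order all_algebra.
From mathcomp Require Import finmap.
From mathcomp Require Import all_classical all_reals.
From mathcomp Require Import Rstruct exp.
(* The notations of multinomials and of mathcomp-analysis are incompatible. *)
From mathcomp Require Import -(notations) mpoly.
From mathcomp Require Import zify ring lra.
Set Implicit Arguments.
Unset Strict Implicit.
Unset Printing Implicit Defensive.
Import Order.TTheory GRing.Theory Num.Theory.
Local Open Scope ring_scope.

(** * The Fischer product on polynomials *)

Section Fischer.
Context (R : rcfType) (d : nat).
Implicit Types (p q : mpoly d R) (x y : 'I_d -> R) (m : multinom d).

Definition var (i : 'I_d) : mpoly d R := mpolyX R (mnm1 i).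

(** Sorted tuples of indices encode the multinomials of degree [k] once each, so the length of the
    list is a binomial coefficient. *)
Definition monomials k : seq (multinom d) := [seq s2m t | t : k.-tuple 'I_d <- enum (basis d k)].

Lemma mem_monomials k m : (m \in monomials k) = (mdeg m == k).
Proof. by rewrite basis_cover. Qed.

Definition mfact m : R := \prod_i ((m i)`!)%:R.

(** On homogeneous parts of degree [k] this is p(D) q: the factorial weights make multiplication by
    a variable adjoint to differentiation. *)
Definition fischer k p q : R :=
  \sum_(m <- monomials k) mfact m * (mcoeff m p * mcoeff m q).

Lemma fischerC k p q : fischer k p q = fischer k q p.
Proof. by apply: eq_bigr => m _; rewrite [mcoeff m p * _]mulrC. Qed.

Lemma fischerD k p p' q : fischer k (p + p') q = fischer k p q + fischer k p' q.
Proof.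
by rewrite -big_split; apply: eq_bigr => m _ /=; rewrite mcoeffD; ring.
Qed.

Lemma fischerZ k c p q : fischer k (c *: p) q = c * fischer k p q.
Proof.
by rewrite mulr_sumr; apply: eq_bigr => m _; rewrite mcoeffZ; ring.
Qed.

Lemma fischer0 k q : fischer k 0 q = 0.
Proof. by rewrite -[0 in LHS](scale0r (0 : mpoly d R)) fischerZ mul0r. Qed.

Lemma fischer_sum k (F : 'I_d -> mpoly d R) q :
  fischer k (\sum_i F i) q = \sum_i fischer k (F i) q.
Proof.
by apply: (big_morph (fun p => fischer k p q)) => [p p'|]; rewrite ?fischerD ?fischer0.
Qed.

Lemma fischer1 : fischer 0 1 1 = 1.
Proof.
have /perm_small_eq e : perm_eq (monomials 0) [:: mnm0].
  apply: uniq_perm; rewrite ?uniq_basis // => m.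
  by rewrite mem_monomials mdeg_eq0 inE.
rewrite /fischer e // big_seq1 mcoeff1 eqxx /= !mulr1 /mfact big1 // => i _.
by rewrite mnm0E.
Qed.

Lemma mfactU m i : mfact (mnm_add m (mnm1 i)) = (m i).+1%:R * mfact m.
Proof.
rewrite /mfact (bigD1 i) //= [in RHS](bigD1 i) //= mulrA; congr (_ * _).
  by rewrite mnmDE mnm1E eqxx addn1 factS natrM.
apply: eq_bigr => j /negPf ji.
by rewrite mnmDE mnm1E eq_sym ji addn0.
Qed.

(** Monomials free of the variable contribute nothing on the left. Each other one is a shift of a
    monomial of degree [k], and its factorial weight grows by the factor that differentiation brings
    out. *)
Lemma fischer_var k i p q : fischer k.+1 (var i * p) q = fischer k p (mderiv i q).
Proof.
pose shift m := mnm_add m (mnm1 i).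
have sub m : (0 < m i)%N -> shift (mnm_sub m (mnm1 i)) = m.
  move=> mi; apply/mnmP => j; rewrite mnmDE mnmBE mnm1E.
  by case: eqP => [<-|_]; rewrite ?subn0 ?addn0 //= subnK.
rewrite /fischer (bigID (fun m : multinom d => (0 < m i)%N)) /= [X in _ + X]big1 ?addr0; last first.
  move=> m; rewrite -eqn0Ngt => /eqP mi0.
  suff -> : mcoeff m (var i * p) = 0 by rewrite mul0r mulr0.
  apply: memN_msupp_eq0; apply/negP => /msuppM_le /allpairsP [[a b] /= [+ _ me]].
  rewrite /var msuppX inE => /eqP ae; move: mi0.
  by rewrite me ae mnmDE mnm1E eqxx.
rewrite -big_filter.
have P : perm_eq [seq m : multinom d <- monomials k.+1 | (0 < m i)%N]
                            [seq shift m | m : multinom d <- monomials k].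
  apply: uniq_perm => [||m].
  - exact/filter_uniq/uniq_basis.
  - rewrite map_inj_uniq ?uniq_basis // => m1 m2 /mnmP e; apply/mnmP => j.
    by move: (e j); rewrite !mnmDE => /addIn.
  - rewrite mem_filter mem_monomials; apply/andP/mapP => [[mi /eqP dm]|[m' + ->]].
      exists (mnm_sub m (mnm1 i)); last by rewrite sub.
      rewrite mem_monomials -eqSS -dm -[in eqbRHS](sub m mi) /shift mdegD mdeg1.
      by rewrite addn1.
    rewrite mem_monomials => /eqP dm; split.
      by rewrite mnmDE mnm1E eqxx addn1.
    by rewrite /shift mdegD mdeg1 addn1 dm.
rewrite (perm_big _ P) big_map; apply: eq_bigr => m _.
rewrite mfactU mcoeff_deriv /var mulrC -mulr_natl.
have -> : mcoeff (shift m) (mpolyX R (mnm1 i) * p) = mcoeff m p.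
  by rewrite mulrC /shift [mnm_add m _]addmC mcoeffMX.
rewrite /shift -!mulrA mulrC; ring.
Qed.

(** * Differential operators, and the adjoints of multiplication by linear forms and by |X|^2 *)

Definition lin x : mpoly d R := \sum_i x i *: var i.
Definition sqn : mpoly d R := \sum_i var i * var i.
Definition dir x p : mpoly d R := \sum_i x i *: mderiv i p.
Definition lap p : mpoly d R := \sum_i mderiv i (mderiv i p).
Definition eul p : mpoly d R := \sum_i var i * mderiv i p.
Definition dotp x y : R := \sum_i x i * y i.

Lemma fischer_lin k x p q : fischer k.+1 (lin x * p) q = fischer k p (dir x q).
Proof.
rewrite /lin mulr_suml fischer_sum [RHS]fischerC /dir fischer_sum.
apply: eq_bigr => i _; rewrite -scalerAl !fischerZ fischer_var.
by rewrite [in RHS]fischerC.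
Qed.

Lemma fischer_sqn k p q : fischer k.+2 (sqn * p) q = fischer k p (lap q).
Proof.
rewrite /sqn mulr_suml fischer_sum [RHS]fischerC /lap fischer_sum.
by apply: eq_bigr => i _; rewrite -mulrA !fischer_var fischerC.
Qed.

Lemma mderiv_var i j : mderiv i (var j) = ((i == j)%:R : mpoly d R).
Proof.
rewrite /var mderivX mnm1E eq_sym; case: eqP => [->|_]; last by rewrite scale0r.
rewrite scale1r; have -> : mnm_sub (mnm1 j) (mnm1 j) = mnm0 :> multinom d.
  by apply/mnmP => l; rewrite mnmBE mnm0E subnn.
exact: mpolyX0.
Qed.

Lemma mderiv1 i : mderiv i (1 : mpoly d R) = 0.
Proof. by rewrite -mpolyC1 mderivC. Qed.

Lemma mderiv_lin i x : mderiv i (lin x) = x i *: (1 : mpoly d R).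
Proof.
rewrite /lin linear_sum (bigD1 i) //= mderivZ mderiv_var eqxx big1 ?addr0 // => j /negPf ji.
by rewrite mderivZ mderiv_var eq_sym ji scaler0.
Qed.

Lemma mderiv_sqn i : mderiv i sqn = 2 * var i.
Proof.
rewrite /sqn linear_sum (bigD1 i) //= mderivM mderiv_var eqxx big1 => [|j /negPf ji].
  by rewrite mulr1n addr0; ring.
by rewrite mderivM mderiv_var eq_sym ji mulr0n; ring.
Qed.

Lemma dirD x p q : dir x (p + q) = dir x p + dir x q.
Proof. by rewrite /dir -big_split; apply: eq_bigr => i _; rewrite mderivD scalerDr. Qed.

Lemma dirM x p q : dir x (p * q) = dir x p * q + p * dir x q.
Proof.
rewrite /dir mulr_suml mulr_sumr -big_split; apply: eq_bigr => i _ /=.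
by rewrite mderivM scalerDr scalerAl scalerAr.
Qed.

Lemma dirZ x c p : dir x (c *: p) = c *: dir x p.
Proof.
rewrite /dir scaler_sumr; apply: eq_bigr => i _.
by rewrite mderivZ !scalerA mulrC.
Qed.

Lemma dir1 x : dir x 1 = 0.
Proof. by rewrite /dir big1 // => i _; rewrite mderiv1 scaler0. Qed.

Lemma dir_lin x y : dir x (lin y) = dotp x y *: 1.
Proof.
rewrite /dir /dotp scaler_suml; apply: eq_bigr => i _.
by rewrite mderiv_lin scalerA.
Qed.

Lemma dir_sqn x : dir x sqn = 2 * lin x.
Proof.
rewrite /dir /lin mulr_sumr; apply: eq_bigr => i _.
by rewrite mderiv_sqn scalerAr.
Qed.

Lemma eulM p q : eul (p * q) = eul p * q + p * eul q.
Proof.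
rewrite /eul mulr_suml mulr_sumr -big_split; apply: eq_bigr => i _ /=.
by rewrite mderivM; ring.
Qed.

Lemma eulD p q : eul (p + q) = eul p + eul q.
Proof. by rewrite /eul -big_split; apply: eq_bigr => i _; rewrite mderivD mulrDr. Qed.

Lemma eulZ c p : eul (c *: p) = c *: eul p.
Proof.
by rewrite /eul scaler_sumr; apply: eq_bigr => i _; rewrite mderivZ scalerAr.
Qed.

Lemma eul1 : eul 1 = 0.
Proof. by rewrite /eul big1 // => i _; rewrite mderiv1 mulr0. Qed.

Lemma eul_lin x : eul (lin x) = lin x.
Proof.
rewrite /eul /lin; apply: eq_bigr => i _.
by rewrite mderiv_lin -scalerAr mulr1.
Qed.

Lemma eul_sqn : eul sqn = 2 * sqn.
Proof.
rewrite /eul /sqn mulr_sumr; apply: eq_bigr => i _.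
by rewrite mderiv_sqn; ring.
Qed.

Lemma lapD p q : lap (p + q) = lap p + lap q.
Proof. by rewrite /lap -big_split; apply: eq_bigr => i _; rewrite !mderivD. Qed.

Lemma lapZ c p : lap (c *: p) = c *: lap p.
Proof.
by rewrite /lap scaler_sumr; apply: eq_bigr => i _; rewrite !mderivZ.
Qed.

Lemma lap1 : lap 1 = 0.
Proof. by rewrite /lap big1 // => i _; rewrite mderiv1 mderiv0. Qed.

Lemma lap_linM x p : lap (lin x * p) = 2 * dir x p + lin x * lap p.
Proof.
rewrite /lap /dir !mulr_sumr -big_split; apply: eq_bigr => i _ /=.
rewrite mderivM mderivD !mderivM mderiv_lin mderivZ mderiv1 scaler0.
by rewrite -!scalerAl -scalerAr !mul1r !mul0r -!mul_mpolyC; ring.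
Qed.

Lemma lap_sqnM p : lap (sqn * p) = d.*2%:R * p + 4 * eul p + sqn * lap p.
Proof.
have -> : d.*2%:R = \sum_(i < d) 2 :> mpoly d R.
  by rewrite sumr_const card_ord -mulrnA mul2n.
rewrite /lap /eul !mulr_sumr !mulr_suml -!big_split; apply: eq_bigr => i _ /=.
rewrite -mulr_suml -/sqn mderivM mderivD !mderivM mderiv_sqn mderivM.
rewrite mderiv_var eqxx mulr1n.
have -> : mderiv i (2 : mpoly d R) = 0 by rewrite mderivMn mderiv1 mul0rn.
by ring.
Qed.
End Fischer.

(** * Gegenbauer kernels *)

Section Gegenbauer.
Context (R : rcfType) (e : nat).
Let d := e.+2.
Implicit Types (x y : 'I_d -> R) (t : R) (n : nat).

(* Gegenbauer polynomials of the unit sphere of R^(e+2). *)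
Fixpoint geg n t : R :=
  match n with
  | 0 => 1
  | n'.+1 => match n' with
     | 0 => t
     | n''.+1 => ((2 * n' + e)%:R * (t * geg n' t) - n'%:R * geg n'' t) / (n' + e)%:R
     end
  end.

(* For a unit vector [x], the homogenisation |X|^n P_n(x.X/|X|). *)
Fixpoint zonal x n : mpoly d R :=
  match n with
  | 0 => 1
  | n'.+1 => match n' with
     | 0 => lin x
     | n''.+1 => ((n' + e)%:R^-1 : R) *:
         ((2 * n' + e)%:R * (lin x * zonal x n') - n'%:R * (sqn R d * zonal x n''))
     end
  end.

(** The coefficient of (x.X)^n in [zonal x n] modulo |X|^2. *)
Fixpoint zonal_lead n : R :=
  match n with
  | 0 => 1
  | n'.+1 => match n' with
     | 0 => 1
     | n''.+1 => (2 * n' + e)%:R / (n' + e)%:R * zonal_lead n'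
     end
  end.

Let nz n : (n.+1 + e)%:R != 0 :> R.
Proof. by rewrite pnatr_eq0. Qed.

Lemma gegSS n t : (n.+1 + e)%:R * geg n.+2 t =
  (2 * n.+1 + e)%:R * (t * geg n.+1 t) - n.+1%:R * geg n t.
Proof. by rewrite [geg n.+2 t]/= mulrC divfK. Qed.

Lemma geg1 n : geg n 1 = 1.
Proof.
suff : geg n 1 = 1 /\ geg n.+1 1 = 1 by case.
elim: n => [|n [IH1 IH2]] //; split=> //.
apply: (mulfI (nz n)); rewrite gegSS IH1 IH2 !natrD natrM; ring.
Qed.

(** Cleared of its denominator, for use with [ring]; [mulnI] cancels the integer factor. *)
Lemma zonalSS x n : (n.+1 + e)%:R * zonal x n.+2 =
  (2 * n.+1 + e)%:R * (lin x * zonal x n.+1) - n.+1%:R * (sqn R d * zonal x n).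
Proof.
rewrite [zonal x n.+2]/=; set p := (X in _ *: X).
by rewrite mulr_natl -scaler_nat scalerA mulfV ?scale1r.
Qed.

Let mulnI n (p q : mpoly d R) : (n.+1 + e)%:R * p = (n.+1 + e)%:R * q -> p = q.
Proof.
rewrite !mulr_natl -!scaler_nat => /(congr1 (GRing.scale (n.+1 + e)%:R^-1)).
by rewrite !scalerA mulVf ?scale1r.
Qed.

Let dirMn x k (p : mpoly d R) : dir x (k%:R * p) = k%:R * dir x p.
Proof. by rewrite !mulr_natl -!scaler_nat dirZ. Qed.
Let eulMn k (p : mpoly d R) : eul (k%:R * p) = k%:R * eul p.
Proof. by rewrite !mulr_natl -!scaler_nat eulZ. Qed.
Let lapMn k (p : mpoly d R) : lap (k%:R * p) = k%:R * lap p.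
Proof. by rewrite !mulr_natl -!scaler_nat lapZ. Qed.
Let dirN x (p : mpoly d R) : dir x (- p) = - dir x p.
Proof. by rewrite -scaleN1r dirZ scaleN1r. Qed.
Let eulN (p : mpoly d R) : eul (- p) = - eul p.
Proof. by rewrite -scaleN1r eulZ scaleN1r. Qed.
Let lapN (p : mpoly d R) : lap (- p) = - lap p.
Proof. by rewrite -scaleN1r lapZ scaleN1r. Qed.

Lemma nat_ind2 (P : nat -> Prop) :
  P 0 -> P 1 -> (forall n, P n -> P n.+1 -> P n.+2) -> forall n, P n.
Proof.
move=> P0 P1 PS n; suff : P n /\ P n.+1 by case.
by elim: n => [|n [IH1 IH2]]; split=> //; apply: PS.
Qed.

(** Uses one known equation modulo [ring], once its multiplier [k] has been supplied. *)
Lemma lincomb (A : pzRingType) (k a b u v : A) : a = b -> u - v = k * (a - b) -> u = v.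
Proof. by move=> ->; rewrite subrr mulr0 => /eqP; rewrite subr_eq0 => /eqP. Qed.

(** Differentiating the recurrence along [x] leaves, by induction, a multiple of the recurrence one
    degree lower. *)
Lemma dir_zonal x n : dotp x x = 1 -> dir x (zonal x n.+1) = n.+1%:R * zonal x n.
Proof.
move=> x1; have dl : dir x (lin x) = 1 by rewrite dir_lin x1 scale1r.
elim/nat_ind2: n => [||n IH1 IH2].
- by rewrite /= dl; ring.
- apply: (mulnI (n := 0)); rewrite -dirMn zonalSS dirD dirN !dirMn !dirM dl dir_sqn dir1 /=.
  ring.
- apply: (mulnI (n := n.+1)); rewrite -dirMn zonalSS dirD dirN !dirMn !dirM dl dir_sqn IH1 IH2.
  apply: (lincomb (k := - n.+2%:R) (zonalSS x n)); ring.
Qed.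

Lemma eul_zonal x n : eul (zonal x n) = n%:R * zonal x n.
Proof.
elim/nat_ind2: n => [||n IH1 IH2].
- by rewrite /= eul1 mul0r.
- by rewrite /= eul_lin mul1r.
- apply: (mulnI (n := n)); rewrite -eulMn zonalSS eulD eulN !eulMn !eulM eul_lin eul_sqn IH1 IH2.
  apply: (lincomb (k := - n.+2%:R) (zonalSS x n)); ring.
Qed.

Lemma lap_lin x : lap (lin x) = 0 :> mpoly d R.
Proof. by rewrite -[lin x]mulr1 lap_linM dir1 lap1; ring. Qed.

(** Harmonicity. In the Laplacian of the recurrence, the derivative along [x] from the first term
    and the dimension and Euler terms from the second are multiples of the same zonal polynomial,
    and they cancel. *)
Lemma lap_zonal x n : dotp x x = 1 -> lap (zonal x n) = 0.
Proof.
move=> x1; elim/nat_ind2: n => [||n IH1 IH2]; rewrite /= ?lap1 ?lap_lin //.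
apply: (mulnI (n := n)); rewrite -lapMn zonalSS lapD lapN !lapMn lap_linM lap_sqnM.
rewrite IH1 IH2 dir_zonal // eul_zonal /d.
have -> : e.+2.*2%:R = 2 * e%:R + 4 :> mpoly d R by rewrite -muln2; ring.
ring.
Qed.

Lemma zonal_lead_gt0 n : 0 < zonal_lead n.
Proof.
elim/nat_ind2: n => [||n _ IH]; rewrite ?ltr01 //=.
by rewrite mulr_gt0 ?divr_gt0 // ltr0n; lia.
Qed.

Lemma zonal_leadE x n :
  exists p, zonal x n.+2 = zonal_lead n.+2 *: lin x ^+ n.+2 + sqn R d * p.
Proof.
have step m (q : mpoly d R) :
    zonal x m.+1 = zonal_lead m.+1 *: lin x ^+ m.+1 + sqn R d * q ->
    exists p, zonal x m.+2 = zonal_lead m.+2 *: lin x ^+ m.+2 + sqn R d * p.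
  move=> E; pose N : mpoly d R := (m.+1 + e)%:R.
  pose u : mpoly d R := ((m.+1 + e)%:R^-1)%:A.
  have Nu : N * u = 1 by rewrite /N mulr_natl -scaler_nat scalerA mulfV // scale1r.
  have NL : N * (zonal_lead m.+2)%:A = (2 * m.+1 + e)%:R * (zonal_lead m.+1)%:A.
    rewrite /N !mulr_natl -!scaler_nat !scalerA [zonal_lead m.+2]/=.
    by rewrite mulrA [X in X * _]mulrC divfK.
  pose A : mpoly d R := (2 * m.+1 + e)%:R * (lin x * q) - m.+1%:R * zonal x m.
  exists (u * A); apply: (mulnI (n := m)); rewrite zonalSS E -/N.
  rewrite -[in RHS]mulr_algl -[in LHS]mulr_algl.
  transitivity (N * (zonal_lead m.+2)%:A * lin x ^+ m.+2 + N * u * (sqn R d * A)); last by ring.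
  by rewrite Nu NL /A; move: (_%:A) (zonal x m) (lin x) (sqn R d) => a z l r; rewrite !exprS; ring.
have [q E] : exists q, zonal x n.+1 = zonal_lead n.+1 *: lin x ^+ n.+1 + sqn R d * q.
  elim: n => [|n [q /step //]]; exists 0; by rewrite /= scale1r expr1 mulr0 addr0.
exact: step E.
Qed.

Lemma dir_lin_exp x y n : dir x (lin y ^+ n.+1) = (n.+1%:R * dotp x y) *: lin y ^+ n.
Proof.
elim: n => [|n IH]; first by rewrite expr1 dir_lin expr0 mul1r.
rewrite exprS dirM IH dir_lin -scalerAl mul1r -scalerAr -exprS -scalerDl.
congr (_ *: _); ring.
Qed.

Lemma lap_lin_exp y n : dotp y y = 1 ->
  lap (lin y ^+ n.+2) = (n.+2%:R * n.+1%:R) *: lin y ^+ n.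
Proof.
move=> y1; elim: n => [|n IH]; rewrite exprS lap_linM dir_lin_exp y1.
  by rewrite expr1 lap_lin mulr0 addr0 mulr_natl -scaler_nat scalerA !mulr1.
rewrite IH -!scalerAr -exprS [2 * (_ : mpoly d R)]mulr_natl -[_ *+ 2]scaler_nat scalerA -scalerDl.
congr (_ *: _); ring.
Qed.

(** Pairing with (x.X)^n evaluates at [x], up to the factor n!. Expanding [zonal y] by its
    recurrence, the adjoints of [lin y] and [sqn] act on the power of [lin x] and lower its degree,
    which reproduces the recurrence of [geg]. *)
Lemma fischer_lin_exp x y n : dotp x x = 1 ->
  fischer n (lin x ^+ n) (zonal y n) = n`!%:R * geg n (dotp x y).
Proof.
move=> x1; have dC : dotp y x = dotp x y by apply: eq_bigr => i _; rewrite mulrC.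
elim/nat_ind2: n => [||n IH1 IH2].
- by rewrite expr0 fischer1 fact0 mul1r.
- rewrite expr1 -[lin x]mulr1 fischer_lin /= dir_lin fischerC fischerZ fischer1.
  by rewrite mulr1 mul1r.
- have E k (p q : mpoly d R) m : fischer k (m%:R * p) q = m%:R * fischer k p q.
    by rewrite mulr_natl -scaler_nat fischerZ.
  apply: (mulfI (nz n)); rewrite mulrCA gegSS fischerC -E zonalSS fischerD.
  rewrite -scaleN1r fischerZ !E fischer_lin fischer_sqn dir_lin_exp lap_lin_exp //.
  rewrite ![fischer _ (zonal _ _) _]fischerC !fischerZ IH1 IH2 dC !factS !natrM.
  by ring.
Qed.

(* Multiplication by |X|^2 is adjoint to the Laplacian, which kills [zonal y n]: only the
   term of [zonal x n] free of |X|^2 contributes. *)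
Lemma fischer_zonal x y n : dotp x x = 1 -> dotp y y = 1 ->
  fischer n (zonal x n) (zonal y n) = zonal_lead n * n`!%:R * geg n (dotp x y).
Proof.
move=> x1 y1; rewrite -mulrA -fischer_lin_exp // -fischerZ.
case: n => [|[|n]]; first by rewrite expr0 scale1r.
  by rewrite expr1 scale1r.
have [p ->] := zonal_leadE x n.
by rewrite fischerD fischer_sqn lap_zonal // [fischer n p 0]fischerC fischer0 addr0.
Qed.

Lemma mfact_ge0 (m : multinom d) : 0 <= mfact R m.
Proof. by apply: prodr_ge0 => i _; apply: ler0n. Qed.

(** The Fischer product is diagonal in the monomials with nonnegative weights, so scaling each
    coefficient of the zonal polynomial by the root of its weight gives the Gram form. *)
Lemma geg_gram n : exists F : 'I_('C(n + e.+1, n)) -> ('I_d -> R) -> R,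
  forall x y, dotp x x = 1 -> dotp y y = 1 ->
  geg n (dotp x y) = \sum_k F k x * F k y.
Proof.
pose c := zonal_lead n * n`!%:R.
have c0 : 0 < c by rewrite mulr_gt0 ?zonal_lead_gt0 // ltr0n fact_gt0.
have sz : size (monomials d n) = 'C(n + e.+1, n) by rewrite size_basis.
pose w (m : multinom d) : R := Num.sqrt (mfact R m / c).
pose M (k : 'I_('C(n + e.+1, n))) := nth mnm0 (monomials d n) k.
exists (fun k x => w (M k) * mcoeff (M k) (zonal x n)) => x y x1 y1.
apply: (mulfI (lt0r_neq0 c0)); rewrite -fischer_zonal // mulr_sumr /fischer.
rewrite (big_nth mnm0) sz big_mkord; apply: eq_bigr => k _; rewrite -/(M k).
have ww : w (M k) * w (M k) = mfact R (M k) / c.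
  by rewrite -expr2 sqr_sqrtr // divr_ge0 ?mfact_ge0 // ltW.
by rewrite [w _ * _ * _]mulrACA ww; move: (lt0r_neq0 c0) => ?; field.
Qed.
End Gegenbauer.

(** * The linear programming bound *)

Arguments geg : simpl never.

Section GramSums.
Context (R : realFieldType) (I : finType).

(** Schur's product theorem in summed form: the products of a feature of [F] and one of [G] are the
    features of the product kernel. *)
Lemma gram_mul_sum (m n : nat) (F : 'I_m -> I -> R) (G : 'I_n -> I -> R) :
  \sum_i \sum_j (\sum_k F k i * F k j) * (\sum_l G l i * G l j) =
  \sum_k \sum_l (\sum_i F k i * G l i) ^+ 2.
Proof.
transitivity (\sum_i \sum_j \sum_k \sum_l (F k i * G l i) * (F k j * G l j)).
  apply: eq_bigr => i _; apply: eq_bigr => j _; rewrite mulr_suml.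
  apply: eq_bigr => k _; rewrite mulr_sumr; apply: eq_bigr => l _; ring.
transitivity (\sum_i \sum_k \sum_l \sum_j (F k i * G l i) * (F k j * G l j)).
  apply: eq_bigr => i _; rewrite exchange_big; apply: eq_bigr => k _.
  exact: exchange_big.
rewrite exchange_big; apply: eq_bigr => k _; rewrite exchange_big.
apply: eq_bigr => l _; rewrite expr2 mulr_suml; apply: eq_bigr => i _.
by rewrite mulr_sumr.
Qed.

Lemma sqr_sum_le (n : nat) (a : 'I_n -> R) :
  (\sum_k a k) ^+ 2 <= n%:R * \sum_k a k ^+ 2.
Proof.
have : 0 <= \sum_k \sum_l (a k - a l) ^+ 2.
  by apply: sumr_ge0 => k _; apply: sumr_ge0 => l _; apply: sqr_ge0.
have -> : \sum_k \sum_l (a k - a l) ^+ 2 =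
    2 * (n%:R * \sum_k a k ^+ 2 - (\sum_k a k) ^+ 2).
  transitivity (\sum_k (n%:R * a k ^+ 2 + \sum_l a l ^+ 2 - 2 * (a k * \sum_l a l))).
    apply: eq_bigr => k _.
    have -> : n%:R * a k ^+ 2 = \sum_(l < n) a k ^+ 2.
      by rewrite sumr_const card_ord mulr_natl.
    rewrite !mulr_sumr -sumrN -!big_split; apply: eq_bigr => l _ /=; ring.
  rewrite !big_split sumrN -!mulr_sumr -mulr_suml sumr_const card_ord -mulr_natl /=; ring.
by lra.
Qed.

(** The kernel matrix has trace [#|I|] and rank at most [n]. Its Frobenius norm equals that of the
    dual [n] by [n] matrix, of which the diagonal is kept and bounded by Cauchy-Schwarz. *)
Lemma gram_sqr_sum_ge (n : nat) (F : 'I_n -> I -> R) :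
  (forall i, \sum_k F k i * F k i = 1) ->
  #|I|%:R ^+ 2 <= n%:R * \sum_i \sum_j (\sum_k F k i * F k j) ^+ 2.
Proof.
move=> F1; under eq_bigr do under eq_bigr do rewrite expr2; rewrite gram_mul_sum.
have -> : #|I|%:R = \sum_k \sum_i F k i * F k i :> R.
  rewrite exchange_big /= (eq_bigr (fun=> 1)) => [|i _]; last exact: F1.
  by rewrite sumr_const.
apply: le_trans (sqr_sum_le _) _; rewrite ler_wpM2l ?ler0n //.
apply: ler_sum => k _; rewrite (bigD1 k) //= lerDl.
by apply: sumr_ge0 => l _; apply: sqr_ge0.
Qed.
End GramSums.

Section LinearProgramming.
Context (R : rcfType) (e : nat) (I : finType) (x : I -> 'I_e.+2 -> R).
Hypothesis x1 : forall i, dotp (x i) (x i) = 1.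

Definition geg_corr (m n : nat) : R := \sum_i \sum_j
  geg e m (dotp (x i) (x j)) * geg e n (dotp (x i) (x j)).

Lemma geg_corr_ge0 m n : 0 <= geg_corr m n.
Proof.
have [[F EF] [G EG]] := (geg_gram R e m, geg_gram R e n).
rewrite /geg_corr; under eq_bigr do under eq_bigr do rewrite EF // EG //.
rewrite (gram_mul_sum (fun k i => F k (x i)) (fun k i => G k (x i))).
by apply: sumr_ge0 => k _; apply: sumr_ge0 => l _; apply: sqr_ge0.
Qed.

Lemma geg_corr_diag n : #|I|%:R ^+ 2 <= 'C(n + e.+1, n)%:R * geg_corr n n.
Proof.
have [F EF] := geg_gram R e n.
rewrite /geg_corr; under eq_bigr do under eq_bigr do rewrite -expr2 EF //.
apply: (@gram_sqr_sum_ge _ _ _ (fun k i => F k (x i))) => i.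
by rewrite -EF // x1 geg1.
Qed.

Definition gup n : R := (n + e)%:R / (2 * n + e)%:R.
Definition gdown n : R := n%:R / (2 * n + e)%:R.

Lemma mul_geg n (t : R) : t * geg e n.+1 t = gup n.+1 * geg e n.+2 t + gdown n.+1 * geg e n t.
Proof.
have nz : (2 * n.+1 + e)%:R != 0 :> R by rewrite pnatr_eq0; lia.
by rewrite /gup /gdown ![_ / _ * _]mulrAC -mulrDl gegSS subrK [_ / _]mulrC mulKf.
Qed.

(** The main sum treats [c 0] and [c n.+1] as if they belonged to the window. The brackets correct
    this and add the terms that leave the window at its two ends. *)
Lemma mul_geg_sum k n (c : nat -> R) t :
  t * \sum_(i < n) c i.+1 * geg e (k + i).+1 t =
  \sum_(i < n) (c i * gup (k + i) + c i.+2 * gdown (k + i.+2)) * geg e (k + i).+1 t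
  + (c n * gup (k + n) * geg e (k + n).+1 t - c 0 * gup k * geg e k.+1 t)
  + (c 1 * gdown k.+1 * geg e k t - c n.+1 * gdown (k + n).+1 * geg e (k + n) t).
Proof.
elim: n => [|n IH]; first by rewrite !big_ord0 addn0; ring.
rewrite !big_ord_recr /= mulrDr IH [t * (_ * _)]mulrCA mul_geg !addnS; ring.
Qed.

(* Pair the kernel [(t - s) g(t)], which has nonnegative Gegenbauer coefficients [h],
   with [g] itself. *)
Lemma lp_bound k n (c : nat -> R) s :
  s <= 1 -> (forall i j, i != j -> dotp (x i) (x j) <= s) ->
  (forall i, 0 <= c i) -> c 0 = 0 -> c n.+2 = 0 ->
  let h i := c i * gup (k + i) + c i.+2 * gdown (k + i.+2) - s * c i.+1 in
  (forall i, (i <= n)%N -> 0 <= h i) ->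
  #|I|%:R * (h 0 * c 1) <=
    'C(k.+1 + e.+1, k.+1)%:R * ((1 - s) * (\sum_(i < n.+1) c i.+1) ^+ 2).
Proof.
move=> s1 xs c_ge0 c0 cn h h_ge0.
pose g (t : R) := \sum_(i < n.+1) c i.+1 * geg e (k + i).+1 t.
(* Pairing with [g] over all pairs of points is linear in [f] and nonnegative on every Gegenbauer
   polynomial. *)
pose B (f : R -> R) : R := \sum_i \sum_j f (dotp (x i) (x j)) * g (dotp (x i) (x j)).
have BD f1 f2 : B (fun t => f1 t + f2 t) = B f1 + B f2.
  rewrite /B -big_split; apply: eq_bigr => i _; rewrite -big_split.
  by apply: eq_bigr => j _; rewrite mulrDl.
have BZ a f : B (fun t => a * f t) = a * B f.
  rewrite /B mulr_sumr; apply: eq_bigr => i _; rewrite mulr_sumr.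
  by apply: eq_bigr => j _; rewrite mulrA.
have Bsum m (f : 'I_m -> R -> R) : B (fun t => \sum_(i < m) f i t) = \sum_(i < m) B (f i).
  rewrite /B [RHS]exchange_big; apply: eq_bigr => i _; rewrite [RHS]exchange_big.
  by apply: eq_bigr => j _; rewrite mulr_suml.
have Beq f1 f2 : f1 =1 f2 -> B f1 = B f2.
  by move=> f12; rewrite /B; apply: eq_bigr => i _; apply: eq_bigr => j _; rewrite f12.
have Bgeg m : B (geg e m) = \sum_(i < n.+1) c i.+1 * geg_corr m (k + i).+1.
  rewrite /B /g /geg_corr; under [RHS]eq_bigr do rewrite mulr_sumr.
  rewrite [RHS]exchange_big; apply: eq_bigr => i _; under [RHS]eq_bigr do rewrite mulr_sumr.
  rewrite [RHS]exchange_big; apply: eq_bigr => j _; rewrite mulr_sumr.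
  by apply: eq_bigr => l _; ring.
have Bgeg_ge0 m : 0 <= B (geg e m).
  by rewrite Bgeg sumr_ge0 // => i _; rewrite mulr_ge0 ?geg_corr_ge0.
have Bgeg1 : c 1 * geg_corr k.+1 k.+1 <= B (geg e k.+1).
  rewrite Bgeg big_ord_recl /= addn0 lerDl.
  by rewrite sumr_ge0 // => i _; rewrite mulr_ge0 ?geg_corr_ge0.
(* As [c] vanishes at both ends of the window, the only boundary terms are those that leave it, and
   they have nonnegative coefficients. *)
have gE t : (t - s) * g t = \sum_(i < n.+1) h i * geg e (k + i).+1 t
    + (c n.+1 * gup (k + n.+1) * geg e (k + n.+1).+1 t + c 1 * gdown k.+1 * geg e k t).
  rewrite mulrBl /g mul_geg_sum c0 cn mulr_sumr.
  have -> : \sum_(i < n.+1) h i * geg e (k + i).+1 t =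
    \sum_(i < n.+1) (c i * gup (k + i) + c i.+2 * gdown (k + i.+2)) * geg e (k + i).+1 t
    - \sum_(i < n.+1) s * (c i.+1 * geg e (k + i).+1 t).
    by rewrite -sumrN -big_split; apply: eq_bigr => i _ /=; rewrite /h; ring.
  ring.
(* All terms are nonnegative; only the correlation of degree [k.+1] with itself is kept, for the
   rank bound. *)
have lower : h 0 * (c 1 * geg_corr k.+1 k.+1) <= B (fun t => (t - s) * g t).
  rewrite (Beq _ _ gE) !BD Bsum big_ord_recl addn0 !BZ -!addrA.
  apply: ler_wpDr; last by rewrite ler_wpM2l // h_ge0.
  have up_ge0 m : 0 <= gup m by rewrite divr_ge0.
  have down_ge0 m : 0 <= gdown m by rewrite divr_ge0.
  apply: addr_ge0; last by apply: addr_ge0; apply: mulr_ge0 => //; apply: mulr_ge0.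
  apply: sumr_ge0 => i _.
  by rewrite BZ mulr_ge0 // h_ge0 // -ltnS; case: i.
have g1 : g 1 = \sum_(i < n.+1) c i.+1.
  by apply: eq_bigr => i _; rewrite geg1 mulr1.
(* Off the diagonal t <= s makes (t - s) g(t)^2 nonpositive; on the diagonal t = 1. *)
have upper : B (fun t => (t - s) * g t) <= #|I|%:R * ((1 - s) * (\sum_(i < n.+1) c i.+1) ^+ 2).
  rewrite -g1 mulr_natl -sumr_const; apply: ler_sum => i _.
  rewrite (bigD1 i) //= x1 -mulrA -expr2 gerDl; apply: sumr_le0 => j ji.
  rewrite -mulrA -expr2 mulr_le0_ge0 ?sqr_ge0 // subr_le0; apply: xs.
  by rewrite eq_sym.
have diag := geg_corr_diag k.+1.
have [I0|I0] := eqVneq #|I| 0%N.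
  by rewrite I0 mul0r mulr_ge0 ?ler0n //; apply: mulr_ge0; rewrite ?sqr_ge0 ?subr_ge0.
have N0 : 0 < #|I|%:R :> R by rewrite ltr0n lt0n.
rewrite -(ler_pM2l N0).
have := le_trans lower upper; set C := 'C(_, _)%:R in diag *; move=> H.
have C0 : 0 <= C by rewrite ler0n.
have hc0 : 0 <= h 0 * c 1 by rewrite mulr_ge0 // h_ge0.
have := ler_wpM2r hc0 diag; have := ler_wpM2l C0 H; rewrite expr2; lra.
Qed.
End LinearProgramming.

(** * Kissing numbers *)

(** A single term of the binomial expansion. With u : v close to a : b the bound on the coefficient
    has the right exponential order. *)
Lemma bin_expr_le (R : realDomainType) (a b : nat) (u v : R) : 0 <= u -> 0 <= v ->
  'C(a + b, a)%:R * (u ^+ a * v ^+ b) <= (u + v) ^+ (a + b).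
Proof.
move=> u0 v0; rewrite [u + v]addrC exprDn.
have ha : (a < (a + b).+1)%N by rewrite ltnS leq_addr.
rewrite (bigD1 (Ordinal ha)) //= addKn mulr_natl [v ^+ b * _]mulrC lerDl.
by apply: sumr_ge0 => i _; rewrite mulrn_wge0 // mulr_ge0 // exprn_ge0.
Qed.

(** The left side is the growth of C(27q, 2q) when [q] increases by one, that is, over 25
    dimensions. *)
Lemma numeric_rate (R : realFieldType) : 27 ^+ 27 / (2 ^+ 2 * 25 ^+ 25) <= (4 / 3) ^+ 25 :> R.
Proof. lra. Qed.

Section Kissing.
Context (R : rcfType).

(** Approximates the square root of 27/2, the limiting ratio of [gup] to [gdown] at degree 2q in
    dimension 25q, so that the factor [gam ^+ i] nearly symmetrises the recurrence. The parabola
    [wt] vanishes at 0 and 202 and serves as an approximate top eigenvector on the window. *)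
Let gam : R := 11 / 3.
Let wt (i : nat) : nat := (i * (202 - i))%N.
Let coef (i : nat) : R := gam ^+ i * (wt i)%:R.

(** The limits of [gup] and [gdown] are 27/29 and 2/29. For these [q] the drift over the window is
    small enough that [gup / gam] and [gdown * gam] stay above 101/400, just over 1/4. *)
Let gup_ge (q e i : nat) : (e.+2 = 25 * q)%N -> (1213 <= q)%N -> (i <= 200)%N ->
  101 / 400 * gam <= gup R e (2 * q + i).
Proof.
move=> eq q_ge i_le; rewrite /gup ler_pdivlMr; last by rewrite ltr0n; lia.
have E : e%:R = 25 * q%:R - 2 :> R.
  have := congr1 (fun n => n%:R : R) eq; rewrite -natr1 -natr1 natrM; lra.
have q1 : (1213%:R : R) <= q%:R by rewrite ler_nat.
have i1 : i%:R <= 200%:R :> R by rewrite ler_nat.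
rewrite !(natrD, natrM) E /gam; lra.
Qed.

Let gdown_ge (q e i : nat) : (e.+2 = 25 * q)%N -> (1213 <= q)%N -> (i <= 200)%N ->
  101 / 400 / gam <= gdown R e (2 * q + i.+2).
Proof.
move=> eq q_ge i_le; rewrite /gdown ler_pdivlMr; last by rewrite ltr0n; lia.
have E : e%:R = 25 * q%:R - 2 :> R.
  have := congr1 (fun n => n%:R : R) eq; rewrite -natr1 -natr1 natrM; lra.
have q1 : (1213%:R : R) <= q%:R by rewrite ler_nat.
have i1 : i%:R <= 200%:R :> R by rewrite ler_nat.
have i0 : 0 <= i%:R :> R by rewrite ler0n.
rewrite -[i.+2]addn2 !(natrD, natrM) E /gam; lra.
Qed.

(* With [k = 2q] the block has dimension [25 q], so that the degree is [0.08] times the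
   dimension, where the Jacobi matrix of the Gegenbauer recurrence has spectral radius
   about [0.507 > 1/2]; a window of width 200 suffices to bring the Rayleigh quotient
   above 1/2. *)
Lemma kissing_bound_block : exists2 K : R, 0 <= K & forall (q e : nat) (I : finType)
    (x : I -> 'I_e.+2 -> R), (e.+2 = 25 * q)%N -> (1213 <= q)%N ->
  (forall i, dotp (x i) (x i) = 1) -> (forall i j, i != j -> dotp (x i) (x j) <= 1 / 2) ->
  #|I|%:R <= K * (4 / 3) ^+ e.+2.
Proof.
pose S : R := \sum_(i < 201) coef i.+1.
(* [1 / 2 * S ^+ 2] is (1 - s) g(1)^2 at s = 1/2; the factor 25/2 comes from the exponents 2q + 1
   and 25q - 1 standing in place of 2q and 25q. *)
exists (25 / 2 * (1 / 2 * S ^+ 2)).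
  by apply: mulr_ge0; [lra | apply: mulr_ge0; [lra | apply: sqr_ge0]].
move=> q e I x eq q_ge x1 x2.
pose h (i : nat) : R := coef i * gup R e (2 * q + i)
  + coef i.+2 * gdown R e (2 * q + i.+2) - 1 / 2 * coef i.+1.
have g0 : 0 < gam by rewrite /gam; lra.
(* The second difference of [wt] is -2, so with w = [wt i.+1] the rescaled [h i] is at least 101/400
   (2w - 2) - w/2 = (w - 101)/200, and w >= 201. *)
have h_ge i : (i <= 200)%N -> gam ^+ i.+1 / 2 <= h i.
  move=> i_le; have U := gup_ge eq q_ge i_le; have D := gdown_ge eq q_ge i_le.
  have wE : (wt i + wt i.+2 + 2 = 2 * wt i.+1)%N by rewrite /wt; nia.
  have w_ge : (201 <= wt i.+1)%N by rewrite /wt; nia.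
  have {}wE : (wt i)%:R + (wt i.+2)%:R + 2 = 2 * (wt i.+1)%:R :> R.
    by rewrite -natrM -wE !natrD.
  have {}w_ge : 201%:R <= (wt i.+1)%:R :> R by rewrite ler_nat.
  have -> : h i = gam ^+ i.+1 * ((wt i)%:R * (gup R e (2 * q + i) / gam)
      + (wt i.+2)%:R * (gdown R e (2 * q + i.+2) * gam) - (wt i.+1)%:R / 2).
    rewrite /h /coef !exprS; field; exact: lt0r_neq0.
  rewrite ler_pM2l ?exprn_gt0 //.
  have U' : 101 / 400 <= gup R e (2 * q + i) / gam by rewrite ler_pdivlMr.
  have D' : 101 / 400 <= gdown R e (2 * q + i.+2) * gam by rewrite -ler_pdivrMr.
  have := ler_wpM2l (ler0n R (wt i)) U'; have := ler_wpM2l (ler0n R (wt i.+2)) D'.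
  lra.
have coef_ge0 i : 0 <= coef i by rewrite mulr_ge0 ?ler0n // exprn_ge0 // ltW.
have c0 : coef 0 = 0 by rewrite /coef mulr0.
have c1 : coef 202 = 0 by rewrite /coef /wt subnn muln0 mulr0.
have s1 : 1 / 2 <= 1 :> R by lra.
have hp i : (i <= 200)%N -> 0 <= h i.
  move=> /h_ge; apply: le_trans; rewrite divr_ge0 ?exprn_ge0 // ltW //.
have := lp_bound x1 s1 x2 coef_ge0 c0 c1 hp.
rewrite -/(h 0) -/S.
have hc : 1 <= h 0%N * coef 1%N.
  have h0 := h_ge 0%N isT; rewrite /coef /wt !expr1 in h0 *.
  have -> : (1 * (202 - 1))%N%:R = 201 :> R by [].
  move: h0; rewrite /gam; lra.
have T0 : 0 <= (1 - 1 / 2) * S ^+ 2 by apply: mulr_ge0; [lra | apply: sqr_ge0].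
move=> H; apply: le_trans (ler_peMr (ler0n _ _) hc) _; apply: le_trans H _.
have -> : 25 / 2 * (1 / 2 * S ^+ 2) * (4 / 3) ^+ e.+2 =
  (25 / 2 * (4 / 3) ^+ e.+2) * ((1 - 1 / 2) * S ^+ 2) by field.
rewrite ler_wpM2r //.
have E1 : ((2 * q).+1 + e.+1 = 27 * q)%N by lia.
(* The weights 2 and 25 are in the ratio of the degree 2q to the dimension 25q. *)
have := bin_expr_le (2 * q).+1 e.+1 (ler0n R 2) (ler0n R 25).
have p0 : 0 < (2 : R) ^+ (2 * q).+1 * 25 ^+ e.+1 by rewrite mulr_gt0 ?exprn_gt0 ?ltr0n.
rewrite -ler_pdivlMr // => {}H; apply: le_trans H _.
have -> : 2%:R + 25%:R = 27 :> R by ring.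
have rearrange (a u v : R) (k l m : nat) : u != 0 -> v != 0 -> (e.+2 = m * q)%N ->
    a ^+ (k * q) / (u ^+ (l * q).+1 * v ^+ e.+1) = v / u * (a ^+ k / (u ^+ l * v ^+ m)) ^+ q.
  move=> u0 v0 em; have -> : v ^+ e.+1 = v ^+ (m * q) / v.
    by rewrite -em [v ^+ e.+2]exprSr mulfK.
  by rewrite exprS !exprM expr_div_n exprMn; field; rewrite u0 v0 !expf_neq0.
rewrite E1 (rearrange _ _ _ _ _ _ _ _ eq) ?pnatr_eq0 //.
rewrite ler_pM2l; last by lra.
rewrite eq exprM lerXn2r ?nnegrE ?numeric_rate //.
  by rewrite divr_ge0 // ?mulr_ge0 // exprn_ge0.
by rewrite exprn_ge0 //; lra.
Qed.

(** Padding the vectors with zeros up to a dimension 25q keeps all inner products and adds at most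
    25 * 1214 dimensions, which the constant absorbs. *)
Lemma kissing_bound : exists2 K : R, 0 < K & forall (d : nat) (I : finType)
    (x : I -> 'I_d -> R), (forall i, dotp (x i) (x i) = 1) ->
    (forall i j, i != j -> dotp (x i) (x j) <= 1 / 2) ->
  #|I|%:R <= K * (4 / 3) ^+ d.
Proof.
have [K K0 HK] := kissing_bound_block.
exists ((K + 1) * (4 / 3) ^+ (25 * 1214)).
  by apply: mulr_gt0; [lra | rewrite exprn_gt0 //; lra].
move=> d I x x1 x2; pose q := (d %/ 25 + 1214)%N; pose e := (25 * q - 2)%N.
have eq : (e.+2 = 25 * q)%N by rewrite /e /q; lia.
pose xx i (k : nat) : R := if insub k is Some k' then x i k' else 0.
pose y i (k : 'I_e.+2) : R := xx i k.
have d_le : (d <= e.+2)%N by rewrite eq /q; lia.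
have dotE i j : dotp (y i) (y j) = dotp (x i) (x j).
  have -> : dotp (x i) (x j) = \sum_(k < d) xx i k * xx j k.
    by apply: eq_bigr => k _; rewrite /xx valK.
  rewrite (big_ord_widen _ (fun k => xx i k * xx j k) d_le) [RHS]big_mkcond.
  apply: eq_bigr => k _; rewrite /y /xx; case: ifP => // /negbT kd.
  by rewrite insubN // mul0r.
have y1 i : dotp (y i) (y i) = 1 by rewrite dotE.
have y2 i j : i != j -> dotp (y i) (y j) <= 1 / 2 by rewrite dotE; apply: x2.
apply: le_trans (HK q e I y eq _ y1 y2) _; first by rewrite /q; lia.
rewrite -mulrA -exprD; apply: ler_pM => //; [|lra|].
  by rewrite exprn_ge0 //; lra.
rewrite ler_weXn2l //; first lra.
by rewrite eq /q; lia.
Qed.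

End Kissing.

(** * Balls around points of the torus *)

Lemma frac_ge0 (t : RR) : 0 <= Defs.frac t.
Proof. by rewrite subr_ge0 floor_le. Qed.

Lemma frac_lt1 (t : RR) : Defs.frac t < 1.
Proof. rewrite /Defs.frac; have := floorD1_gt t; rewrite intrD; lra. Qed.

Lemma fracDz (t : RR) (z : int) : Defs.frac (t + z%:~R) = Defs.frac t.
Proof. by rewrite /Defs.frac floorDrz ?intr_int // intrKfloor intrD; ring. Qed.

Lemma frac_id (t : RR) : 0 <= t < 1 -> Defs.frac t = t.
Proof. by move=> t01; rewrite /Defs.frac (@floor_def _ t 0) ?subr0. Qed.

Lemma fracE (t : RR) : exists z : int, Defs.frac t = t + z%:~R.
Proof. by exists (- Num.floor t); rewrite /Defs.frac intrN. Qed.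

Lemma distZDz (t : RR) (z : int) : distZ (t + z%:~R) = distZ t.
Proof. by rewrite /distZ fracDz. Qed.

Lemma distZ_ge0 (t : RR) : 0 <= distZ t.
Proof. by rewrite /distZ le_min frac_ge0 subr_ge0 ltW ?frac_lt1. Qed.

Lemma distZ_le_norm (t : RR) : distZ t <= `|t|.
Proof.
have [t0|t0] := leP 0 t.
  have f0 : (0%:~R : RR) <= (Num.floor t)%:~R by rewrite ler_int floor_ge0.
  by rewrite ger0_norm // /distZ ge_min /Defs.frac; apply/orP; left; lra.
have f0 : (Num.floor t)%:~R <= ((- 1)%:~R : RR).
  by rewrite ler_int -ltzD1 addNr ltNge floor_ge0 -ltNge.
rewrite ltr0_norm // /distZ ge_min /Defs.frac; apply/orP; right.
rewrite intrN in f0; lra.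
Qed.

(** The representative of [t] modulo 1 in (-1/2, 1/2], used to lift a torus vector to a Euclidean
    one of the same length. *)
Definition centered (t : RR) : RR :=
  if Defs.frac t <= 1 - Defs.frac t then Defs.frac t else Defs.frac t - 1.

Lemma centeredE (t : RR) : exists z : int, centered t = t + z%:~R.
Proof.
have [z E] := fracE t; rewrite /centered E; case: ifP => _; first by exists z.
by exists (z - 1); rewrite intrD intrN addrA.
Qed.

Lemma sqr_centered (t : RR) : centered t ^+ 2 = distZ t ^+ 2.
Proof.
rewrite /centered /distZ minElt; have [h|h] := leP (Defs.frac t) (1 - Defs.frac t).
  case: ltP => // h'; have -> : 1 - Defs.frac t = Defs.frac t by lra.
  by [].
rewrite ltNge ltW //=; ring.
Qed.

Lemma distZN (t : RR) : distZ (- t) = distZ t.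
Proof.
have le s : distZ (- s) <= distZ s.
  have [z E] := centeredE s.
  have -> : - s = - centered s + z%:~R by rewrite E; ring.
  rewrite distZDz; apply: le_trans (distZ_le_norm _) _.
  by rewrite normrN -ler_sqr ?nnegrE ?distZ_ge0 // real_normK ?num_real // sqr_centered.
by apply/eqP; rewrite eq_le le /= -[t in X in X <= _]opprK le.
Qed.

Lemma distZ_eq0 (t : RR) : distZ t = 0 -> exists z : int, t = z%:~R.
Proof.
move=> t0; have [z E] := centeredE t.
have /eqP : centered t ^+ 2 = 0 by rewrite sqr_centered t0 expr0n.
rewrite sqrf_eq0 E => /eqP H; exists (- z); rewrite intrN; lra.
Qed.

Lemma tnorm_ge0 d (x : vec d) : 0 <= tnorm x.
Proof. exact: sqrtr_ge0. Qed.

Lemma sqr_tnorm d (x : vec d) : tnorm x ^+ 2 = \sum_i distZ (x ord0 i) ^+ 2.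
Proof. by rewrite sqr_sqrtr // sumr_ge0 // => i _; apply: sqr_ge0. Qed.

Lemma eq_tnorm d (x y : vec d) :
  (forall i, distZ (x ord0 i) = distZ (y ord0 i)) -> tnorm x = tnorm y.
Proof. by move=> xy; rewrite /tnorm; under eq_bigr do rewrite xy. Qed.

Lemma distZ_red d (x : vec d) i : distZ (red x ord0 i) = distZ (x ord0 i).
Proof. by rewrite mxE; have [z ->] := fracE (x ord0 i); rewrite distZDz. Qed.

Lemma tnorm_red d (x : vec d) : tnorm (red x) = tnorm x.
Proof. by apply: eq_tnorm => i; rewrite distZ_red. Qed.

Lemma tnormN d (x : vec d) : tnorm (- x) = tnorm x.
Proof. by apply: eq_tnorm => i; rewrite mxE distZN. Qed.

Lemma tnorm_tsubC d (x y : vec d) : tnorm (tsub x y) = tnorm (tsub y x).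
Proof. by rewrite !tnorm_red -tnormN opprB. Qed.

Lemma redP d (x : vec d) : exists z : 'I_d -> int, forall i, red x ord0 i = x ord0 i + (z i)%:~R.
Proof.
by exists (fun i => - Num.floor (x ord0 i)) => i; rewrite mxE /Defs.frac intrN.
Qed.

Lemma red_eqz d (x y : vec d) (z : 'I_d -> int) :
  (forall i, x ord0 i = y ord0 i + (z i)%:~R) -> red x = red y.
Proof. by move=> E; apply/rowP => i; rewrite !mxE E fracDz. Qed.

Lemma red_id d (x : vec d) : is_torus_pt x -> red x = x.
Proof. by move=> xT; apply/rowP => i; rewrite mxE frac_id // xT. Qed.

Lemma is_torus_pt_red d (x : vec d) : is_torus_pt (red x).
Proof. by move=> i; rewrite mxE frac_ge0 frac_lt1. Qed.

Lemma taddE d (x y : vec d) : exists z : 'I_d -> int,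
  forall i, tadd x y ord0 i = x ord0 i + y ord0 i + (z i)%:~R.
Proof. by have [z E] := redP (x + y); exists z => i; rewrite /tadd E mxE. Qed.

Lemma tsubE d (x y : vec d) : exists z : 'I_d -> int,
  forall i, tsub x y ord0 i = x ord0 i - y ord0 i + (z i)%:~R.
Proof. by have [z E] := redP (x - y); exists z => i; rewrite /tsub E !mxE. Qed.

Lemma subE d (x y : vec d) i : (x - y) ord0 i = x ord0 i - y ord0 i.
Proof. by rewrite !mxE. Qed.

Lemma tsub_tadd d (x y z : vec d) : tsub (tadd x z) (tadd y z) = tsub x y.
Proof.
have [u U] := taddE x z; have [v V] := taddE y z.
apply: (@red_eqz _ _ _ (fun i => u i - v i)) => i.
by rewrite !subE U V intrD intrN; ring.
Qed.

Lemma tnorm_tsub_tadd d (s a b : vec d) : tnorm (tsub s (tadd a b)) = tnorm (tsub a (tsub s b)).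
Proof.
rewrite [RHS]tnorm_tsubC !tnorm_red; apply: eq_tnorm => i.
have [u U] := taddE a b; have [v V] := tsubE s b; rewrite !subE U V.
transitivity (distZ (s ord0 i - a ord0 i - b ord0 i)).
  rewrite -[RHS](distZDz _ (- u i)) intrN; congr distZ; ring.
by rewrite -[LHS](distZDz _ (v i)); congr distZ; ring.
Qed.

Lemma tadd_inj d (a x y : vec d) : is_torus_pt x -> is_torus_pt y ->
  tadd a x = tadd a y -> x = y.
Proof.
move=> xT yT E; rewrite -(red_id xT) -(red_id yT).
have [u U] := taddE a x; have [v V] := taddE a y.
apply: (@red_eqz _ _ _ (fun i => v i - u i)) => i.
have := U i; rewrite E V intrD intrN; lra.
Qed.

Lemma tnorm_tsub_eq0 d (x y : vec d) : is_torus_pt x -> is_torus_pt y ->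
  tnorm (tsub x y) = 0 -> x = y.
Proof.
move=> xT yT; rewrite tnorm_red => n0; have := sqr_tnorm (x - y).
rewrite n0 expr0n /= => /esym/eqP; rewrite psumr_eq0 => [/allP H|i _]; last exact: sqr_ge0.
have H' i : exists z : int, x ord0 i - y ord0 i = z%:~R.
  apply: distZ_eq0; have /implyP/(_ isT) := H i (mem_index_enum i).
  by rewrite sqrf_eq0 !mxE => /eqP.
apply/rowP => i; rewrite -[x ord0 i]frac_id // -[RHS]frac_id //.
by have [z E] := H' i; rewrite -(fracDz (y ord0 i) z) -E addrC subrK.
Qed.

Lemma tnorm_le_sum d (u v : 'I_d -> RR) (x : vec d) (z : 'I_d -> int) :
  (forall i, u i - v i = x ord0 i + (z i)%:~R) -> tnorm x ^+ 2 <= \sum_i (u i - v i) ^+ 2.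
Proof.
move=> E; rewrite sqr_tnorm; apply: ler_sum => i _.
rewrite -[leRHS]real_normK ?num_real // lerXn2r ?nnegrE ?distZ_ge0 //.
by rewrite -(distZDz (x ord0 i) (z i)) -E distZ_le_norm.
Qed.

(** Lift each a - p to a shortest vector u_a. Then |u_a| <= |N_a - a| <= |b - a| <= |u_a - u_b|, and
    likewise for |u_b|, so the side opposite the origin is the longest and the angle there is at
    least 60 degrees. The point [p] itself has no direction; it is set aside and costs the [+ 1]. *)
Lemma multiplicity_bound : exists2 K : RR, 0 < K &
  forall d (A : {fset vec d}) (N : vec d -> vec d) (p : vec d),
  (forall a, a \in A -> is_torus_pt a) -> is_torus_pt p -> nearest_sel A N ->
  #|` [fset a in A | tnorm (tsub a p) <= tnorm (tsub (N a) a)]%fset |%:R <= K * (4 / 3) ^+ d.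
Proof.
have [K K0 HK] := kissing_bound RR.
exists (K + 1); first lra.
move=> d A N p AT pT HN; set E := [fset a in A | _]%fset.
pose E' := (E `\ p)%fset.
have EA a : a \in E' -> [/\ a != p, a \in A & tnorm (tsub a p) <= tnorm (tsub (N a) a)].
  by rewrite !inE => /and3P[].
pose u (a : E') (i : 'I_d) : RR := centered (tsub (val a) p ord0 i).
pose n (a : E') := tnorm (tsub (val a) p).
have un a : \sum_i u a i ^+ 2 = n a ^+ 2.
  by rewrite sqr_tnorm; apply: eq_bigr => i _; rewrite sqr_centered.
have n0 a : 0 < n a.
  rewrite lt_def tnorm_ge0 andbT; apply/eqP => /tnorm_tsub_eq0 ap.
  have [/eqP + aA _] := EA _ (valP a); apply; apply: ap => //; exact: AT.
have sep a b : a != b -> n a ^+ 2 <= \sum_i (u a i - u b i) ^+ 2.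
  move=> ab; have [_ aA ra] := EA _ (valP a); have [_ bA _] := EA _ (valP b).
  have [_ _ Nmin] := HN _ aA.
  have ba : val b != val a by rewrite eq_sym (inj_eq val_inj).
  have le1 : n a <= tnorm (tsub (val b) (val a)) by apply: le_trans ra (Nmin _ bA ba).
  apply: (@le_trans _ _ (tnorm (tsub (val b) (val a)) ^+ 2)).
    by rewrite lerXn2r ?nnegrE ?tnorm_ge0.
  rewrite tnorm_tsubC tnorm_red.
  have /choice [za Za] : forall i, exists z : int, u a i = tsub (val a) p ord0 i + z%:~R.
    by move=> i; apply: centeredE.
  have /choice [zb Zb] : forall i, exists z : int, u b i = tsub (val b) p ord0 i + z%:~R.
    by move=> i; apply: centeredE.
  have [va Va] := tsubE (val a) p; have [vb Vb] := tsubE (val b) p.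
  apply: (@tnorm_le_sum _ _ _ _ (fun i => za i - zb i + va i - vb i)) => i.
  by rewrite Za Zb Va Vb subE !intrD !intrN; ring.
pose y (a : E') (i : 'I_d) := u a i / n a.
have yE a b : dotp (y a) (y b) = (\sum_i u a i * u b i) / (n a * n b).
  rewrite mulr_suml; apply: eq_bigr => i _; rewrite /y; field.
  by rewrite !gt_eqF.
have y1 a : dotp (y a) (y a) = 1.
  rewrite yE; under eq_bigr do rewrite -expr2; rewrite un expr2 divff //.
  by rewrite mulf_neq0 // gt_eqF.
have y2 a b : a != b -> dotp (y a) (y b) <= 1 / 2.
  move=> ab; rewrite yE ler_pdivrMr ?mulr_gt0 //.
  have expand c e : \sum_i (u c i - u e i) ^+ 2 =
      n c ^+ 2 + n e ^+ 2 - 2 * \sum_i u c i * u e i.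
    rewrite -!un mulr_sumr -sumrN -!big_split; apply: eq_bigr => i _ /=; ring.
  have := sep a b ab; have := sep b a; rewrite eq_sym ab => /(_ isT).
  rewrite [X in n b ^+ 2 <= X]expand expand.
  have -> : \sum_i u b i * u a i = \sum_i u a i * u b i.
    by apply: eq_bigr => i _; rewrite mulrC.
  have := n0 a; have := n0 b; move: (n a) (n b) (\sum_i _) => s t w t0 s0 h1 h2.
  (* Twice the inner product is at most the smaller of s^2 and t^2, hence at most s t. *)
  have [st|ts] := leP s t; nra.
have := HK d E' y y1 y2; rewrite -cardfE => H.
have : #|` E| %:R <= #|` E'|%:R + 1 :> RR.
  by rewrite natr1 ler_nat (cardfsD1 p E) -/E'; case: (p \in E); rewrite ?add1n ?add0n ?leqnSn.
have : 1 <= (4 / 3) ^+ d :> RR by rewrite exprn_ege1 //; lra.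
by move=> H1 H2; rewrite mulrDl mul1r; apply: (le_trans H2); apply: lerD.
Qed.

Local Open Scope fset_scope.

(** * Counting differences *)

Section Counting.
Local Open Scope ring_scope.

Lemma natr_card_fset (T : choiceType) (X : {fset T}) (P : pred T) :
  (#|` [fset x in X | P x]|)%:R = \sum_(x <- X) (P x)%:R :> RR.
Proof.
rewrite card_fset_sum1 natr_sum -(@big_fset_condE _ _ _ _ X P (fun=> 1)) big_mkcond /=.
by apply: eq_bigr => x _; case: (P x).
Qed.

Lemma natr_cardfs (T : choiceType) (X : {fset T}) : (#|` X|)%:R = \sum_(x <- X) 1 :> RR.
Proof. by rewrite card_fset_sum1 natr_sum. Qed.

Lemma pair_count_le (T1 T2 U1 U2 : choiceType) (X1 : {fset T1}) (X2 : {fset T2})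
    (Y1 : {fset U1}) (Y2 : {fset U2}) (P : T1 -> T2 -> bool) (Q : U1 -> U2 -> bool)
    (f : T1 -> T2 -> U1 * U2) :
  (forall x1 x2, x1 \in X1 -> x2 \in X2 -> P x1 x2 ->
     [/\ (f x1 x2).1 \in Y1, (f x1 x2).2 \in Y2 & Q (f x1 x2).1 (f x1 x2).2]) ->
  (forall x1 x2 x1' x2', x1 \in X1 -> x2 \in X2 -> x1' \in X1 -> x2' \in X2 ->
     f x1 x2 = f x1' x2' -> x1 = x1' /\ x2 = x2') ->
  \sum_(x1 <- X1) \sum_(x2 <- X2) (P x1 x2)%:R <=
  \sum_(y1 <- Y1) \sum_(y2 <- Y2) (Q y1 y2)%:R :> RR.
Proof.
move=> fP f_inj.
(* As lengths of filtered lists of pairs, the two sums can be compared through the injection [f]. *)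
have E (V1 V2 : choiceType) (Z1 : {fset V1}) (Z2 : {fset V2}) (S : V1 -> V2 -> bool) :
    \sum_(z1 <- Z1) \sum_(z2 <- Z2) (S z1 z2)%:R =
    (size [seq z <- [seq (z1, z2) | z1 <- Z1, z2 <- Z2] | S z.1 z.2])%:R :> RR.
  rewrite size_filter -sum1_count [in RHS]big_mkcond big_allpairs_dep natr_sum.
  apply: eq_bigr => z1 _; rewrite natr_sum; apply: eq_bigr => z2 _ /=.
  by case: (S z1 z2).
rewrite !E ler_nat.
rewrite -(size_map (fun z => f z.1 z.2)); apply: uniq_leq_size.
  rewrite map_inj_in_uniq; last first.
    move=> [a b] [a' b']; rewrite !mem_filter /= => /andP[_ /allpairsP[[? ?] /= [? ? [-> ->]]]].
    move=> /andP[_ /allpairsP[[? ?] /= [? ? [-> ->]]]] /f_inj H.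
    by have [-> ->] : _ /\ _ := ltac:(apply: H => //).
  by apply: filter_uniq; apply: allpairs_uniq => // -[? ?] [? ?].
move=> z /mapP[[a b]]; rewrite mem_filter /= => /andP[Pab /allpairsP[[? ?] /= [aX bX [ea eb]]]] ->.
subst; have [] := fP _ _ aX bX Pab; case: (f _ _) => u v /= uY vY Quv.
by rewrite mem_filter Quv allpairs_f.
Qed.

(** The ball that reaches the farthest of the counted points contains all of them. *)
Lemma nearest_ball_count d (S : {fset vec d}) (u : vec d) (k : RR) : 0 <= k ->
  (#|` [fset v in S |
      (#|` [fset s in S | (tnorm (tsub s u) <= tnorm (tsub v u))%R]|)%:R <= k]|)%:R <= k.
Proof.
move=> k0; set Q := [fset v in S | _].
have [->|[v0 v0Q]] := fset_0Vmem Q; first by rewrite cardfs0.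
pose w := [arg max_(v > [` v0Q]) tnorm (tsub (val v) u)]%O.
have wmax v : v \in Q -> tnorm (tsub v u) <= tnorm (tsub (val w) u).
  move=> vQ; rewrite /w; case: arg_maxP => [//|i _ i_max]; exact: (i_max [` vQ] isT).
have := valP w; rewrite /Q !inE => /andP[_]; apply: le_trans.
rewrite ler_nat; apply: fsubset_leq_card; apply/fsubsetP => v vQ.
by rewrite !inE wmax // andbT; move: vQ; rewrite !inE => /andP[].
Qed.

Lemma few_directions d (A B : {fset vec d}) (N : vec d -> vec d) (M eps : RR) :
  (forall a, a \in A -> is_torus_pt a) -> (forall b, b \in B -> is_torus_pt b) ->
  A != fset0 -> B != fset0 -> nearest_sel A N -> 0 < eps -> 0 < M ->
  (forall p, is_torus_pt p ->
    (#|` [fset a in A | (tnorm (tsub a p) <= tnorm (tsub (N a) a))%R]|)%:R <= M) ->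
  exists2 A' : {fset vec d}, A' `<=` A /\ (1 - eps) * (#|` A|)%:R <= (#|` A'|)%:R &
   (#|` [fset tsub (N a) a | a in A']|)%:R <=
     4 * M * (#|` sumset A B|)%:R ^+ 2 / (eps * (#|` A|)%:R * (#|` B|)%:R).
Proof.
move=> AT BT A0 B0 HN eps0 M0 HM; set S := sumset A B.
have SE a b : a \in A -> b \in B -> tadd a b \in S by move=> aA bB; apply: in_imfset2.
pose r a := tnorm (tsub (N a) a).
pose hits a b s : bool := tnorm (tsub s (tadd a b)) <= r a.
pose cA : RR := (#|` A|)%:R; pose cB : RR := (#|` B|)%:R; pose cS : RR := (#|` S|)%:R.
have cA0 : 0 < cA by rewrite ltr0n cardfs_gt0.
have cB0 : 0 < cB by rewrite ltr0n cardfs_gt0.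
have cS0 : 0 < cS.
  rewrite ltr0n cardfs_gt0; have [a aA] := fset0Pn _ A0; have [b bB] := fset0Pn _ B0.
  by apply/fset0Pn; exists (tadd a b); apply: SE.
(* This is 2/eps times the bound M |S| / |A| on the average number of hits per pair. By Markov's
   inequality at most a share eps/2 of the pairs is bad, hence at most a share eps of the points [a]
   has more than half of its pairs bad. *)
pose k : RR := 2 * M * cS / (eps * cA).
have k0 : 0 < k by rewrite divr_gt0 ?mulr_gt0.
pose good a b : bool := (#|` [fset s in S | hits a b s]|)%:R <= k.
pose typical a : bool := (cB <= 2 * \sum_(b <- B) (good a b)%:R)%R.
pose A' := [fset a in A | typical a].
(* For fixed [s] and [b], the ball around a + b contains [s] exactly when the ball around [a]
   contains s - b, so at most [M] points [a] count. *)
have total : \sum_(a <- A) \sum_(b <- B) \sum_(s <- S) (hits a b s)%:R <= M * cS * cB.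
  rewrite exchange_big /= /cB natr_cardfs mulr_sumr big_seq [leRHS]big_seq.
  apply: ler_sum => b bB; rewrite exchange_big /= mulr1 /cS natr_cardfs mulr_sumr.
  apply: ler_sum => s _; rewrite mulr1.
  have := HM (tsub s b) (@is_torus_pt_red _ _).
  rewrite (natr_card_fset A (fun a => tnorm (tsub a (tsub s b)) <= r a)).
  apply: le_trans; apply: ler_sum => a _.
  by rewrite /hits (tnorm_tsub_tadd s a b).
have bad_le a : k * cB * (~~ typical a)%:R <=
    2 * \sum_(b <- B) \sum_(s <- S) (hits a b s)%:R.
  have ge0 : 0 <= \sum_(b <- B) \sum_(s <- S) (hits a b s)%:R :> RR.
    by apply: sumr_ge0 => b _; apply: sumr_ge0 => s _; apply: ler0n.
  have [|] := boolP (typical a); first by rewrite mulr0 mulr_ge0.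
  rewrite /typical -ltNge mulr1 => few.
  have : k * (cB - \sum_(b <- B) (good a b)%:R) <= \sum_(b <- B) \sum_(s <- S) (hits a b s)%:R.
    rewrite /cB natr_cardfs -sumrB mulr_sumr; apply: ler_sum => b _.
    rewrite -(natr_card_fset S (hits a b)) /good.
    set n := (#|` _|)%:R; case: (leP n k) => [_|/ltW]; first by rewrite subrr mulr0 ler0n.
    by rewrite subr0 mulr1.
  have : k * (cB / 2) <= k * (cB - \sum_(b <- B) (good a b)%:R).
    by rewrite ler_pM2l //; lra.
  lra.
have A'_ge : (1 - eps) * cA <= (#|` A'|)%:R.
  have bad_sum : k * cB * \sum_(a <- A) (~~ typical a)%:R <= 2 * (M * cS * cB).
    rewrite mulr_sumr; apply: le_trans (_ : _ <= 2 * _) (ler_wpM2l _ total) => //.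
    by rewrite mulr_sumr; apply: ler_sum => a _; apply: bad_le.
  have : \sum_(a <- A) (~~ typical a)%:R <= eps * cA.
    rewrite -(ler_pM2l (mulr_gt0 k0 cB0)); apply: le_trans bad_sum _.
    rewrite le_eqVlt; apply/orP; left; apply/eqP; rewrite /k; field.
    by rewrite !gt_eqF.
  have : cA = \sum_(a <- A) (typical a)%:R + \sum_(a <- A) (~~ typical a)%:R.
    rewrite /cA natr_cardfs -big_split; apply: eq_bigr => a _ /=.
    by case: (typical a); rewrite ?addr0 ?add0r.
  rewrite (natr_card_fset A typical); lra.
exists A'; first by split=> //; apply: fset_sub.
set D := [fset _ | _ in _].
(* One point of [A'] is fixed for each difference; outside [D] the value is arbitrary. *)
have /choice [sec secP] : forall t, exists a, t \in D -> a \in A' /\ t = tsub (N a) a.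
  move=> t; have [/imfsetP[a /= aA' ->]|tD] := boolP (t \in D); first by exists a.
  by exists t.
have A'A a : a \in A' -> a \in A by rewrite !inE => /andP[].
have lower : (#|` D|)%:R * cB <= 2 * \sum_(t <- D) \sum_(b <- B) (good (sec t) b)%:R.
  rewrite natr_cardfs mulr_suml mulr_sumr big_seq [leRHS]big_seq.
  apply: ler_sum => t /secP [+ _]; rewrite !inE mul1r => /andP[_]; exact.
pose Q u v : bool := (#|` [fset s in S | (tnorm (tsub s u) <= tnorm (tsub v u))%R]|)%:R <= k.
have tsub_shift a b : tsub (tadd (N a) b) (tadd a b) = tsub (N a) a by apply: tsub_tadd.
(* The difference of the two image points is [t], which determines [sec t], and then [b] follows by
   cancellation. *)
have upper : \sum_(t <- D) \sum_(b <- B) (good (sec t) b)%:R <= cS * k.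
  apply: (@le_trans _ _ (\sum_(u <- S) \sum_(v <- S) (Q u v)%:R)).
    apply: (@pair_count_le _ _ _ _ _ _ _ _ _ _
      (fun t b => (tadd (sec t) b, tadd (N (sec t)) b))) => [t b tD bB gd|t b t' b' tD bB t'D b'B].
      have [aA' _] := secP _ tD; have aA := A'A _ aA'; have [NA _ _] := HN _ aA.
      by split; [exact: SE | exact: SE | rewrite /Q /= tsub_shift].
    have [_ tE] := secP _ tD; have [_ tE'] := secP _ t'D.
    move=> [e1 e2]; have tt' : t = t' by rewrite tE tE' -!(tsub_shift _ b) e1 e2 tsub_shift.
    split=> //; move: e1; rewrite -tt'; apply: tadd_inj; exact: BT.
  rewrite /cS natr_cardfs mulr_suml; apply: ler_sum => u _; rewrite mul1r.
  by rewrite -(natr_card_fset S (Q u)) nearest_ball_count // ltW.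
rewrite ler_pdivlMr ?mulr_gt0 // -/cA -/cB -/cS.
(* The 4 collects the 2 in [k] and the 2 lost by keeping half of [B] for each typical point. *)
have -> : 4 * M * cS ^+ 2 = 2 * (cS * k) * (eps * cA).
  by rewrite /k; field; rewrite !gt_eqF.
rewrite mulrCA mulrC ler_pM2r ?mulr_gt0 //; lra.
Qed.

End Counting.

(** * Near-optimal sets B, and the choice of the constants *)

Lemma card_sumset_ge d (A B : {fset vec d}) : A != fset0 ->
  (forall b, b \in B -> is_torus_pt b) -> (#|` B| <= #|` sumset A B|)%N.
Proof.
move=> /fset0Pn [a aA] BT.
have : [fset tadd a b | b in B] `<=` sumset A B.
  by apply/fsubsetP => _ /imfsetP[b /= bB ->]; apply: in_imfset2.
move=> /fsubset_leq_card; rewrite card_in_imfset // => b b' bB b'B.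
by apply: tadd_inj; apply: BT.
Qed.

(* Supplies a single [B0], so that the set A' of the theorem can be chosen before [B]. *)
Lemma exists_near_optimal d (A : {fset vec d}) : A != fset0 ->
  (forall a, a \in A -> is_torus_pt a) ->
  exists2 B0 : {fset vec d}, B0 != fset0 /\ (forall b, b \in B0 -> is_torus_pt b) &
  forall B : {fset vec d}, B != fset0 -> (forall b, b \in B -> is_torus_pt b) ->
  (#|` sumset A B0|)%:R ^+ 2 / (#|` B0|)%:R <=
    2 * ((#|` sumset A B|)%:R ^+ 2 / (#|` B|)%:R) :> RR.
Proof.
move=> A0 AT.
(* The quotients are rounded down to natural numbers, among which a minimum exists. *)
pose attained n := `[< exists B : {fset vec d}, [/\ B != fset0,
  forall b, b \in B -> is_torus_pt b & (#|` sumset A B| ^ 2 %/ #|` B|)%N = n] >].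
have ex : exists n, attained n.
  by exists (#|` sumset A A| ^ 2 %/ #|` A|)%N; apply/asboolP; exists A.
case: (ex_minnP ex) => m /asboolP[B0 [B0n B0T mE]] m_min.
exists B0 => // B Bn BT.
have m_le : (m <= #|` sumset A B| ^ 2 %/ #|` B|)%N.
  by apply: m_min; apply/asboolP; exists B.
have cB0 : (0 < #|` B0|)%N by rewrite cardfs_gt0.
have cB : (0 < #|` B|)%N by rewrite cardfs_gt0.
have SB := card_sumset_ge A0 BT.
rewrite ler_pdivrMr ?ltr0n // mulrA mulrAC ler_pdivlMr ?ltr0n //.
rewrite -!natrX -!natrM ler_nat.
move: mE m_le SB cB0 cB.
move: #|` sumset A B0| #|` B0| #|` sumset A B| #|` B| => s0 b0 s b.
move=> mE m_le sb b0_gt b_gt.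
have h1 : (s0 ^ 2 < m.+1 * b0)%N by rewrite -mE -ltn_divLR.
have h2 : (m * b <= s ^ 2)%N by rewrite -leq_divRL.
(* The competing quotient is at least 1, so the rounding costs at most a factor 2: s0^2/b0 < m + 1
   <= s^2/b + 1 <= 2 s^2/b. *)
have h3 : (b <= s ^ 2)%N by rewrite (leq_trans sb) // expnS expn1 leq_pmulr // (leq_trans b_gt).
nia.
Qed.

Theorem theorem4 :
  exists (K eps0 : RR), 0 < K /\ 0 < eps0 < 1 /\
  forall (d : nat) (A : {fset vec d}) (N : vec d -> vec d) (eps : RR),
    (1 <= d)%N ->
    (forall a, a \in A -> is_torus_pt a) ->
    (2 <= #|` A |)%N ->
    0 < eps -> eps <= eps0 ->
    nearest_sel A N ->
    exists A' : {fset vec d},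
      A' `<=` A /\
      (1 - eps) * (#|` A |)%:R <= (#|` A' |)%:R /\
      forall B : {fset vec d},
        B != fset0 ->
        (forall b, b \in B -> is_torus_pt b) ->
        (#|` [fset tsub (N a) a | a in A'] |)%:R
          <= K * (4 / 3) ^+ d
             * ((#|` sumset A B |)%:R ^+ 2 / ((#|` A |)%:R * (#|` B |)%:R))
             * (1 / eps) * ln (1 / eps).
Proof.
have [K K0 HK] := multiplicity_bound.
have ln2 : 0 < ln (2 : RR) by apply: ln_gt0; lra.
(* The 8 is the 4 of [few_directions] times the 2 of [exists_near_optimal]. For eps <= 1/2 the
   quotient of ln (1/eps) by ln 2 is at least 1. *)
exists (8 * K / ln 2), (1 / 2); split; first by rewrite divr_gt0 // mulr_gt0.
split; first by apply/andP; split; lra.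
move=> d A N eps _ AT A2 eps0 eps_le HN.
have A0 : A != fset0 by rewrite -cardfs_gt0; apply: ltn_trans A2.
have [B0 [B0n B0T] opt] := exists_near_optimal A0 AT.
pose M : RR := (K * (4 / 3) ^+ d)%R.
have M0 : 0 < M by rewrite mulr_gt0 // exprn_gt0 //; lra.
have HM p := HK d A N p AT ^~ HN.
have [A' [A'A A'_ge] A'_le] := few_directions AT B0T A0 B0n HN eps0 M0 HM.
exists A'; split=> //; split=> // B Bn BT; apply: le_trans A'_le _.
have cA : 0 < (#|` A|)%:R :> RR by rewrite ltr0n cardfs_gt0.
have cB0 : 0 < (#|` B0|)%:R :> RR by rewrite ltr0n cardfs_gt0.
have cB : 0 < (#|` B|)%:R :> RR by rewrite ltr0n cardfs_gt0.
have ln_le : ln (2 : RR) <= ln (1 / eps).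
  by rewrite ler_ln ?posrE ?divr_gt0 // ler_pdivlMr //; lra.
move: (opt B Bn BT) cA cB0 cB.
move: ((#|` sumset A B0|)%:R : RR) ((#|` sumset A B|)%:R : RR).
move: ((#|` A|)%:R : RR) ((#|` B|)%:R : RR) ((#|` B0|)%:R : RR) => a b b0 s0 s le0 a0 b0_gt0 b_gt0.
have -> : (4 * M * s0 ^+ 2 / (eps * a * b0) = (4 * M / (eps * a)) * (s0 ^+ 2 / b0))%R.
  by field; rewrite !gt_eqF.
have -> : (8 * K / ln 2 * (4 / 3) ^+ d * (s ^+ 2 / (a * b)) * (1 / eps) * ln (1 / eps) =
   (4 * M / (eps * a)) * (2 * (s ^+ 2 / b) * (ln (1 / eps) / ln 2)))%R.
  by rewrite /M; field; rewrite !gt_eqF.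
apply: ler_wpM2l; first by apply: divr_ge0; apply/ltW/mulr_gt0.
apply: le_trans le0 _; apply: ler_peMr; last by rewrite ler_pdivlMr // [1 * ln 2]mul1r.
by apply: mulr_ge0 => //; apply: divr_ge0; [apply: sqr_ge0 | apply: ltW].
Qed.
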